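(* Let $S$ be a commutative ring and $R$ a subring of $S$ which is an integral domain. Assume that $S$ is a free $R$-module of finite rank $n$, that the $\overline{k}$-algebra $\overline{k}\otimes_RS$ is semisimple (where $k$ is the quotient field of $R$ and $\overline{k}$ its algebraic closure), and that $T$ is Zariski dense in $\widetilde T$. Then the lower garland of the lattice $\mathrm{Lat}(T,\operatorname{GL}(n,R))$ coincides with the interval $\mathrm{Lat}(T,N_{\operatorname{GL}(n,R)}(T))$.
   Context: Rings are associative with unit, subrings are unitary. Fix an $R$-basis $\omega_1,\dots,\omega_n$ of $S$. For $\alpha\in S$ let $t(\alpha)=(t_{ij}(\alpha))\in M(n,R)$ be given by $\omega_i\alpha=\sum_{j=1}^n t_{ji}(\alpha)\omega_j$. Put $T=t(S^* )\leqslant\operatorname{GL}(n,R)$. Extend $t$ by the same formula (with basis $1\otimes\omega_i$) to $\overline{k}\otimes_RS$ and put $\widetilde T=t((\overline{k}\otimes_RS)^* )\leqslant\operatorname{GL}(n,\overline{k})$. For groups $A\leqslant B$, $\mathrm{Lat}(A,B)=\{H: A\leqslant H\leqslant B\}$ is the lattice of intermediate subgroups. Its normality graph has the intermediate subgroups as vertices, two of them being joined by an edge iff one of them is normal in the other. A garland is a connected component of the normality graph; the lower garland is the one containing $A$. $N_{B}(\cdot)$ is the normalizer in $B$. *)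

(* Defs.v *)
From HB Require Import structures.
From Stdlib Require Import Relation_Operators.
From mathcomp Require Import all_boot all_order all_algebra all_classical.
From mathcomp Require mpoly.
Set Implicit Arguments.
Unset Strict Implicit.
Unset Printing Implicit Defensive.
Import GRing.Theory.
Local Open Scope classical_set_scope.
Local Open Scope ring_scope.

Definition is_basis (R : nzRingType) (V : lmodType R) (n : nat)
    (w : 'I_n -> V) : Prop :=
  forall v : V, exists! c : 'cV[R]_n, v = \sum_j c j 0 *: w j.

(* Junk value 0 when v has no coordinates in the family w. *)
Definition coordinates (R : nzRingType) (V : lmodType R) (n : nat)
    (w : 'I_n -> V) (v : V) : 'cV[R]_n :=
  xget 0 [set c : 'cV[R]_n | v = \sum_j c j 0 *: w j].

(* Column i of [mult_mx w a] holds the coordinates of w_i * a, that is,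
   w_i * a = \sum_j (mult_mx w a) j i *: w_j. *)
Definition mult_mx (R : nzRingType) (S : algType R) (n : nat) (w : 'I_n -> S)
    (a : S) : 'M[R]_n :=
  \matrix_(j, i) coordinates w (w i * a) j 0.

Definition torus (R : nzRingType) (S : unitAlgType R) (n : nat)
    (w : 'I_n -> S) : set 'M[R]_n :=
  mult_mx w @` [set a : S | a \is a GRing.unit].

(* Maps f : K -> S -> M that are biadditive and R-balanced, where R acts on K
   through phi. *)
Definition balanced (R : comNzRingType) (K : comNzRingType) (phi : R -> K)
    (S : algType R) (M : zmodType) (f : K -> S -> M) : Prop :=
  [/\ forall x y s, f (x + y) s = f x s + f y s,
      forall x s s', f x (s + s') = f x s + f x s' &
      forall x r s, f (x * phi r) s = f x (r *: s)].

(* The K-algebra A, with iota : S -> A in the role of s |-> 1 (x) s, is the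
   tensor product of K and S over R: the map (x, s) |-> x *: iota s, in the
   role of (x, s) |-> x (x) s, is the universal balanced map on K x S. The
   multiplication is the usual one because iota is a ring morphism and A is
   a K-algebra. *)
Definition is_tensor_algebra (R : comNzRingType) (K : comNzRingType)
    (phi : R -> K) (S : comAlgType R) (A : comAlgType K)
    (iota : {rmorphism S -> A}) : Prop :=
  balanced phi (fun (x : K) (s : S) => x *: iota s) /\
  forall (M : zmodType) (f : K -> S -> M), balanced phi f ->
    exists h : {additive A -> M},
      (forall x s, h (x *: iota s) = f x s) /\
      forall h' : {additive A -> M},
        (forall x s, h' (x *: iota s) = f x s) -> h' =1 h.

Definition left_ideal (A : nzRingType) (I : set A) : Prop :=
  [/\ I 0, forall x y, I x -> I y -> I (x + y) &
      forall a x, I x -> I (a * x)].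

(* A simple submodule of the left regular module. *)
Definition minimal_left_ideal (A : nzRingType) (I : set A) : Prop :=
  [/\ left_ideal I, I != [set 0] &
      forall J : set A, left_ideal J -> J `<=` I -> J = [set 0] \/ J = I].

(* The left regular module is a direct sum of simple modules; such a sum is
   necessarily finite since A has a unit. *)
Definition semisimple (A : nzRingType) : Prop :=
  exists (m : nat) (I : 'I_m -> set A),
    (forall i, minimal_left_ideal (I i)) /\
    forall a : A, exists! x : {ffun 'I_m -> A},
      (forall i, I i (x i)) /\ a = \sum_i x i.

Definition GL (n : nat) (R : comUnitRingType) : set 'M[R]_n :=
  [set M | M \in unitmx].
Arguments GL n R : clear implicits.

Definition zariski_closed (F : fieldType) (n : nat) (Z : set 'M[F]_n) : Prop :=
  exists P : set (mpoly.mpoly (n * n) F),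
    Z = [set M | forall p, P p -> mpoly.meval (mxvec M 0) p = 0].

(* Closure in the affine space of all matrices. The Zariski topology of
   GL(n, F) is the induced one, so density of subsets of GL(n, F) can be
   tested here. *)
Definition zariski_closure (F : fieldType) (n : nat) (X : set 'M[F]_n) :
    set 'M[F]_n :=
  \bigcap_(Z in [set Z | zariski_closed Z /\ X `<=` Z]) Z.

Definition zariski_dense (F : fieldType) (n : nat) (X Y : set 'M[F]_n) : Prop :=
  X `<=` Y /\ Y `<=` zariski_closure X.

Section MatrixGroups.
Variables (R : comUnitRingType) (n : nat).
Implicit Types A B H K : set 'M[R]_n.

Definition subgroup_GL H : Prop :=
  [/\ H `<=` GL n R, H 1%:M,
      forall x y, H x -> H y -> H (x *m y) &
      forall x, H x -> H (invmx x)].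

Definition conjugate (g : 'M[R]_n) H : set 'M[R]_n :=
  (fun x => g *m x *m invmx g) @` H.

Definition normalizer B H : set 'M[R]_n :=
  [set g | B g /\ conjugate g H = H].

Definition normal_in H K : Prop :=
  H `<=` K /\ forall g, K g -> conjugate g H = H.

Definition Lat A B : set (set 'M[R]_n) :=
  [set H | [/\ subgroup_GL H, A `<=` H & H `<=` B]].

Definition normality_edge A B H K : Prop :=
  [/\ Lat A B H, Lat A B K & normal_in H K \/ normal_in K H].

(* The connected component of the vertex H in the normality graph. *)
Definition garland A B H : set (set 'M[R]_n) :=
  [set K | Lat A B K /\ clos_refl_trans _ (normality_edge A B) H K].

Definition lower_garland A B : set (set 'M[R]_n) := garland A B A.

End MatrixGroups.

(* Main.v *)
Require Import Defs.
From HB Require Import structures.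
From mathcomp Require Import all_boot all_order all_algebra all_classical.
From mathcomp Require Import ring.
From mathcomp Require mpoly.
Import (canonicals) mpoly.
Set Implicit Arguments.
Unset Strict Implicit.
Unset Printing Implicit Defensive.
Import GRing.Theory.
Local Open Scope classical_set_scope.
Local Open Scope ring_scope.

(** Write [T] for the torus of [S], [B] for the image of [A] under its regular
    representation over [kbar]. A path in the normality graph starting at [T]
    stays among the subgroups normalizing [T] as soon as every conjugate
    [g T g^-1] that normalizes [T] is contained in [T]
    ([lower_garland_normalizer]); this is the point to be proved.

    A usual argument is that the closure of [T] is a maximal torus, that the
    closure of [g T g^-1] is connected and normalizes it, and that a torus is the
    identity component of its normalizer. Connectedness is replaced here by a
    computation. Suppose that [g T g^-1] normalizes [T], and let [b] be in [T].
    The elements [u b u^-1], with [u] in [g T g^-1], lie in [T], hence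
    commute with [B]. This is a polynomial condition on [u], so by density it holds for all [u = g x g^-1] with [x] a unit of [B]
    ([zariski_dense_conj_commute]), and the commutant of the regular
    representation of a commutative algebra is that representation itself
    ([commutant_mult_mx]): so [u b u^-1] is in [B]. Since [A] is a product of
    copies of [kbar], [B] is spanned by idempotents and is reduced
    ([semisimple_split], [semisimple_reduced]). For [f] in [g B g^-1] idempotent,
    [1 + (l - 1) f] is a unit for all nonzero [l]; comparing two values of [l]
    shows that [f b (1 - f)] and [(1 - f) b f] are in [B]. They have square zero,
    so they vanish and [f] commutes with [b] ([idempotent_commutes]).

    Therefore [g T g^-1] commutes with [T], and with [B] by density again. Being
    defined over [R], it then lies in the commutant of the regular representation
    of [S], which puts it in [T] ([commutant_torus]). *)

(** * The regular representation in a basis *)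

Section RegularRepresentation.
Variables (R : comNzRingType) (S : comAlgType R) (n : nat) (w : 'I_n -> S).
Hypothesis w_basis : is_basis w.

Lemma coordinatesK (v : S) : \sum_j coordinates w v j 0 *: w j = v.
Proof.
have [c [vE _]] := w_basis v.
apply/esym; exact: (@xgetPex _ 0 [set d : 'cV_n | v = \sum_j d j 0 *: w j]
  (ex_intro _ c vE)).
Qed.

Lemma coordinates_unique (v : S) (c : 'cV[R]_n) :
  v = \sum_j c j 0 *: w j -> coordinates w v = c.
Proof.
have [d [_ d_uniq]] := w_basis v => vE.
by rewrite -(d_uniq _ vE) -(d_uniq _ (esym (coordinatesK v))).
Qed.

Lemma coordinates_comb (c : 'cV[R]_n) : coordinates w (\sum_j c j 0 *: w j) = c.
Proof. exact: coordinates_unique. Qed.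

Lemma coordinates_inj : injective (coordinates w).
Proof. by move=> u v uv; rewrite -(coordinatesK u) uv coordinatesK. Qed.

Lemma coordinatesP (a : R) (u v : S) :
  coordinates w (a *: u + v) = a *: coordinates w u + coordinates w v.
Proof.
apply: coordinates_unique; rewrite -{1}(coordinatesK u) -{1}(coordinatesK v).
rewrite scaler_sumr -big_split; apply: eq_bigr => i _ /=.
by rewrite !mxE scalerDl scalerA.
Qed.

Lemma coordinates_sum (c : 'I_n -> R) (f : 'I_n -> S) :
  coordinates w (\sum_i c i *: f i) = \sum_i c i *: coordinates w (f i).
Proof.
have coord0 : coordinates w 0 = 0.
  by apply: coordinates_unique; rewrite big1 // => i _; rewrite mxE scale0r.
elim/big_rec2: _ => // i y x _ <-; exact: coordinatesP.
Qed.

Lemma mult_mx_coordinates (a v : S) :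
  mult_mx w a *m coordinates w v = coordinates w (v * a).
Proof.
rewrite -{2}(coordinatesK v) mulr_suml.
under eq_bigr do rewrite -scalerAl.
rewrite coordinates_sum; apply/colP => i; rewrite !mxE summxE.
by apply: eq_bigr => k _; rewrite !mxE mulrC.
Qed.

(** Coordinate columns exhaust the column space, so a matrix is determined by
    its action on them. *)
Lemma eq_mx_on_coordinates (M N : 'M[R]_n) :
  (forall v, M *m coordinates w v = N *m coordinates w v) -> M = N.
Proof.
move=> MN; apply/matrixP => i k.
have := MN (\sum_l (delta_mx k 0 : 'cV[R]_n) l 0 *: w l).
by rewrite coordinates_comb -!colE => /colP/(_ i); rewrite !mxE.
Qed.

Lemma mult_mxM (a b : S) : mult_mx w (a * b) = mult_mx w a *m mult_mx w b.
Proof.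
apply: eq_mx_on_coordinates => v.
by rewrite -mulmxA !mult_mx_coordinates mulrAC mulrA.
Qed.

Lemma mult_mxC (a b : S) :
  mult_mx w a *m mult_mx w b = mult_mx w b *m mult_mx w a.
Proof. by rewrite -!mult_mxM mulrC. Qed.

Lemma mult_mx1 : mult_mx w 1 = 1%:M.
Proof.
by apply: eq_mx_on_coordinates => v; rewrite mult_mx_coordinates mulr1 mul1mx.
Qed.

Lemma mult_mxP (c : R) (a b : S) :
  mult_mx w (c *: a + b) = c *: mult_mx w a + mult_mx w b.
Proof.
apply: eq_mx_on_coordinates => v.
rewrite mulmxDl -scalemxAl !mult_mx_coordinates -coordinatesP.
by rewrite mulrDr scalerAr.
Qed.

Lemma mult_mxD (a b : S) : mult_mx w (a + b) = mult_mx w a + mult_mx w b.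
Proof. by have := mult_mxP 1 a b; rewrite !scale1r. Qed.

Lemma mult_mx0 : mult_mx w 0 = 0.
Proof. by apply: (addrI (mult_mx w 0)); rewrite -mult_mxD !addr0. Qed.

Lemma mult_mxZ (c : R) (a : S) : mult_mx w (c *: a) = c *: mult_mx w a.
Proof. by rewrite -[c *: a]addr0 mult_mxP mult_mx0 addr0. Qed.

Lemma mult_mxB (a b : S) : mult_mx w (a - b) = mult_mx w a - mult_mx w b.
Proof. by rewrite -scaleN1r addrC mult_mxP scaleN1r addrC. Qed.

Lemma mult_mx_sum (I : finType) (f : I -> S) :
  mult_mx w (\sum_i f i) = \sum_i mult_mx w (f i).
Proof. exact: (big_morph _ mult_mxD mult_mx0). Qed.

Lemma mult_mx_inj : injective (mult_mx w).
Proof.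
move=> a b ab; apply: coordinates_inj.
by rewrite -[a]mul1r -[b]mul1r -!mult_mx_coordinates ab.
Qed.

(** The regular module of a commutative algebra is cyclic, generated by 1: a
    matrix [M] commuting with all multiplications is the multiplication by the
    element with coordinates [M *m coordinates w 1]. *)
Lemma commutant_mult_mx (M : 'M[R]_n) :
  (forall a, M *m mult_mx w a = mult_mx w a *m M) -> exists a, M = mult_mx w a.
Proof.
move=> Mcomm; exists (\sum_j (M *m coordinates w 1) j 0 *: w j).
apply: eq_mx_on_coordinates => v.
rewrite -{1}[v]mul1r -mult_mx_coordinates // mulmxA Mcomm -mulmxA.
by rewrite [RHS]mult_mx_coordinates mulrC -mult_mx_coordinates coordinates_comb.
Qed.

End RegularRepresentation.

(** * Scalar extension *)

Section ScalarExtension.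
Variables (R K : comNzRingType) (phi : {rmorphism R -> K}).
Variables (S : comAlgType R) (n : nat) (w : 'I_n -> S).
Hypothesis w_basis : is_basis w.
Variables (A : comAlgType K) (iota : {rmorphism S -> A}).
Hypothesis A_tensor : is_tensor_algebra phi iota.

Lemma tensor_iotaZ (r : R) (s : S) : iota (r *: s) = phi r *: iota s.
Proof. by have [[_ _ /(_ 1 r s)]] := A_tensor; rewrite mul1r scale1r. Qed.

Lemma tensor_iota_comb (c : 'cV[R]_n) :
  iota (\sum_i c i 0 *: w i) = \sum_i map_mx phi c i 0 *: iota (w i).
Proof.
by rewrite rmorph_sum; apply: eq_bigr => i _; rewrite tensor_iotaZ mxE.
Qed.

(** The [i]-th coordinate on the tensor product is induced by the balanced map
    [(x, s) |-> x * phi (i-th coordinate of s)]. That the coordinates recover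
    every element follows from the uniqueness half of the universal property,
    applied to the identity and to [a |-> \sum_i h i a *: iota (w i)]. *)
Lemma tensor_basis : is_basis (fun i => iota (w i)).
Proof.
have [[bD1 bD2 bZ] univ] := A_tensor.
pose coord_map i (x : K) (s : S) := x * phi (coordinates w s i 0).
have coord_balanced i : balanced phi (coord_map i).
  have coordD s s' : coordinates w (s + s') = coordinates w s + coordinates w s'.
    by have := coordinatesP w_basis 1 s s'; rewrite !scale1r.
  have coordZ r s : coordinates w (r *: s) = r *: coordinates w s.
    apply: (addIr (coordinates w 0)).
    by rewrite -coordinatesP // addr0 -coordD addr0.
  split=> [x y s|x s s'|x r s]; rewrite /coord_map ?mulrDl //.
  - by rewrite coordD mxE rmorphD mulrDr.
  - by rewrite coordZ mxE rmorphM mulrA.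
have /choice [h hP] i := univ _ _ (coord_balanced i).
have hE i x s : h i (x *: iota s) = x * phi (coordinates w s i 0).
  by have [-> _] := hP i.
pose recombine a := \sum_i h i a *: iota (w i).
have recombineB : zmod_morphism recombine.
  move=> a b; rewrite /recombine -sumrB; apply: eq_bigr => i _.
  by rewrite raddfB scalerBl.
pose P : {additive A -> A} :=
  HB.pack recombine (GRing.isZmodMorphism.Build A A recombine recombineB).
have PE : P =1 id.
  have [id' [_ id'P]] := univ _ _ (And3 bD1 bD2 bZ).
  move=> a; rewrite (id'P P) => [|x s]; first exact/esym/(id'P idfun).
  rewrite /= /recombine -{2}(coordinatesK w_basis s) tensor_iota_comb.
  by rewrite scaler_sumr; apply: eq_bigr => i _; rewrite hE scalerA mxE.
move=> a; exists (\col_i h i a); split=> [|c aE].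
  by rewrite -{1}(PE a); apply: eq_bigr => i _; rewrite mxE.
apply/colP => i; rewrite mxE aE raddf_sum (bigD1 i) //= big1 => [|k ki].
  rewrite addr0 hE (_ : coordinates w (w i) = delta_mx i 0).
    by rewrite mxE !eqxx rmorph1 mulr1.
  apply: coordinates_unique => //.
  rewrite (bigD1 i) //= big1 => [|l li]; rewrite mxE ?eqxx ?addr0 ?scale1r //.
  by rewrite (negPf li) scale0r.
rewrite hE (_ : coordinates w (w k) = delta_mx k 0).
  by rewrite mxE eq_sym (negPf ki) rmorph0 mulr0.
apply: coordinates_unique => //.
rewrite (bigD1 k) //= big1 => [|l lk]; rewrite mxE ?eqxx ?addr0 ?scale1r //.
by rewrite (negPf lk) scale0r.
Qed.

Lemma coordinates_tensor (s : S) :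
  coordinates (fun i => iota (w i)) (iota s) = map_mx phi (coordinates w s).
Proof.
apply: (coordinates_unique tensor_basis).
by rewrite -{1}(coordinatesK w_basis s) tensor_iota_comb.
Qed.

Lemma mult_mx_tensor (s : S) :
  mult_mx (fun i => iota (w i)) (iota s) = map_mx phi (mult_mx w s).
Proof.
by apply/matrixP => k i; rewrite !mxE -rmorphM coordinates_tensor mxE.
Qed.

End ScalarExtension.

(** * Commutative semisimple algebras *)

Section SemisimpleRing.
Variable A : comNzRingType.

(** A decomposition of the regular module into simple ideals [I i] cuts 1 into
    orthogonal idempotents [e i], and minimality of [I i = A * e i] makes it a
    field with unit [e i], whose nonzero elements [a * e i] are thus invertible. *)
Lemma semisimple_idempotents : semisimple A ->
  exists (m : nat) (e : 'I_m -> A),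
    [/\ \sum_i e i = 1, forall i, e i * e i = e i &
        forall i a, a * e i != 0 -> exists b, b * (a * e i) = e i].
Proof.
case=> m [I [I_min I_sum]].
have [e [[eI e1] _]] := I_sum 1.
have I_ideal i : left_ideal (I i) by have [] := I_min i.
have I0 i : I i 0 by have [] := I_ideal i.
have IM i a x : I i x -> I i (a * x) by have [_ _] := I_ideal i; apply.
have disjoint i k v : i != k -> I i v -> I k v -> v = 0.
  move=> ik Iv Kv; have [x [_ x_uniq]] := I_sum v.
  have single l : I l v -> x = [ffun l' => if l' == l then v else 0].
    move=> Lv; apply: x_uniq; split=> [l'|].
      by rewrite ffunE; case: eqP => // ->.
    rewrite (bigD1 l) //= big1 => [|l' ll]; rewrite ffunE ?eqxx ?addr0 //.
    by rewrite (negPf ll).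
  have /ffunP/(_ i) := single _ Iv; rewrite {1}(single _ Kv) !ffunE eqxx.
  by rewrite (negPf ik).
have orth i k : i != k -> e i * e k = 0.
  by move=> ik; apply: (disjoint i k) => //; [rewrite mulrC|]; apply: IM.
exists m, e; split=> // [i|i a ae_neq0].
  rewrite -[RHS]mulr1 e1 mulr_sumr (bigD1 i) //= big1 ?addr0 // => k ki.
  by rewrite orth // eq_sym.
pose J := [set x | exists b, x = b * (a * e i)].
have J_ideal : left_ideal J.
  split=> [|_ _ [b ->] [c ->]|c _ [b ->]].
  - by exists 0; rewrite mul0r.
  - by exists (b + c); rewrite -mulrDl.
  - by exists (c * b); rewrite -mulrA.
have JI : J `<=` I i by move=> _ [b ->]; do 2!apply: (IM).
have [_ _ /(_ J J_ideal JI) [J0|JE]] := I_min i.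
  have : J (a * e i) by exists 1; rewrite mul1r.
  by rewrite J0 => /= ae0; rewrite ae0 eqxx in ae_neq0.
have : J (e i) by rewrite JE.
by case=> b bE; exists b.
Qed.

(** If [a e i] is nonzero then [e i = b a e i] for some [b], so
    [a e i = a (b a e i) = b a^2 e i]. *)
Lemma semisimple_reduced : semisimple A -> forall a : A, a * a = 0 -> a = 0.
Proof.
case/semisimple_idempotents=> m [e [e1 _ e_inv]] a aa0.
rewrite -[a]mulr1 -e1 mulr_sumr big1 // => i _; apply/eqP/contraT => ae_neq0.
have [b bE] := e_inv _ _ ae_neq0.
by rewrite -bE !mulrA (mulrAC a b) aa0 !mul0r eqxx in ae_neq0.
Qed.

End SemisimpleRing.

(** Over an algebraically closed field the characteristic polynomial of the
    multiplication by [a] splits, and [a] is a root of it. *)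
Lemma split_annihilator (F : closedFieldType) (A : comAlgType F) (n : nat)
    (w : 'I_n -> A) (w_basis : is_basis w) (a : A) :
  exists r : seq F, \prod_(c <- r) (a - c%:A) = 0.
Proof.
case: n w w_basis => [|n] w w_basis.
  (* An empty basis would give 1 = 0 in A. *)
  have := coordinatesK w_basis 1.
  by rewrite big_ord0 => /esym/eqP; rewrite oner_eq0.
have [r rE] := closed_field_poly_normal (char_poly (mult_mx w a)).
exists r; apply: (mult_mx_inj w_basis); rewrite mult_mx0 //.
rewrite -(Cayley_Hamilton (mult_mx w a)) rE.
rewrite (monicP (char_poly_monic _)) scale1r rmorph_prod.
rewrite (big_morph (mult_mx w) (mult_mxM w_basis) (mult_mx1 w_basis)).
apply: eq_bigr => c _; rewrite rmorphB /= horner_mx_X horner_mx_C.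
by rewrite mult_mxB // mult_mxZ // mult_mx1 // scalemx1.
Qed.

(** Each simple factor is a finite field extension of [F], hence [F] itself. *)
Lemma semisimple_split (F : closedFieldType) (A : comAlgType F) (n : nat)
    (w : 'I_n -> A) : is_basis w -> semisimple A ->
  exists (m : nat) (e : 'I_m -> A),
    (forall i, e i * e i = e i) /\
    forall a, exists c : 'I_m -> F, a = \sum_i c i *: e i.
Proof.
move=> w_basis /semisimple_idempotents [m [e [e1 e_idem e_inv]]].
exists m, e; split=> // a.
suff /choice [c cE] i : exists c, a * e i = c *: e i.
  exists c; rewrite -{1}[a]mulr1 -e1 mulr_sumr.
  by apply: eq_bigr => i _; rewrite cE.
have [e0|e_neq0] := eqVneq (e i) 0; first by exists 0; rewrite e0 mulr0 scale0r.
have [r r0] := split_annihilator w_basis a.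
have : (\prod_(c <- r) (a - c%:A)) * e i = 0 by rewrite r0 mul0r.
elim: r {r0} => [|c r IHr];
  first by rewrite big_nil mul1r => e0; rewrite e0 eqxx in e_neq0.
rewrite big_cons => cr0.
have [ac0|ac_neq0] := eqVneq ((a - c%:A) * e i) 0.
  exists c; apply/eqP; rewrite -subr_eq0 -[c *: e i]mulr_algl -mulrBl.
  by rewrite ac0.
apply: IHr; have [b bE] := e_inv _ _ ac_neq0.
by rewrite -bE mulrCA [X in b * X]mulrCA [X in b * X]mulrA cr0 mulr0.
Qed.

(** * Two values of a one-parameter group of units *)

(** On the image of [f] these are multiplications by [l] and [l^-1], on the
    kernel of [f] both are the identity. *)
Lemma unit_idempotent (F : fieldType) (A : algType F) (f : A) (l : F) :
  f * f = f -> l != 0 ->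
  (1 + (l - 1) *: f) * (1 + (l^-1 - 1) *: f) = 1.
Proof.
move=> ff l_neq0; rewrite mulrDl mul1r mulrDr mulr1 -scalerAl -scalerAr ff.
rewrite scalerA -addrA -!scalerDl -[RHS]addr0 -[in RHS](scale0r f).
by congr (_ + _ *: _); field.
Qed.

Section Pencil.
Variables (F : fieldType) (n : nat) (B : set 'M[F]_n).
Hypothesis BB : forall M N, B M -> B N -> B (M - N).
Hypothesis BZ : forall c M, B M -> B (c *: M).
Hypothesis B_reduced : forall M, B M -> M *m M = 0 -> M = 0.

Lemma conj_pencil (f b : 'M[F]_n) (l : F) : l != 0 ->
  l *: ((1%:M + (l - 1) *: f) *m b *m (1%:M + (l^-1 - 1) *: f) - b) =
  (l - 1) *: (l *: (f *m b - f *m b *m f) - (b *m f - f *m b *m f)).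
Proof.
move=> l_neq0.
rewrite mulmxDl mul1mx mulmxDr mulmx1 mulmxDl -!scalemxAl -!scalemxAr.
move: (f *m b) (b *m f) (f *m b *m f) => x y z.
by apply/matrixP => i k; rewrite !mxE; field.
Qed.

(** Write [u] for the unit [1 + (l - 1) f]. Clearing denominators, the conjugate
    [u b u^-1] differs from [b] by a multiple of [l p - q], where
    [p = f b (1 - f)] and [q = (1 - f) b f]. Two values of [l] put [p] and [q]
    in [B], where they vanish because their squares do. *)
Lemma idempotent_commutes (f b : 'M[F]_n) (l m : F) :
    f *m f = f -> B b ->
    l != 0 -> l != 1 -> m != 0 -> m != 1 -> l != m ->
    (forall c : F, c != 0 ->
      B ((1%:M + (c - 1) *: f) *m b *m (1%:M + (c^-1 - 1) *: f))) ->
  f *m b = b *m f.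
Proof.
move=> ff Bb l0 l1 m0 m1 lm B_conj.
pose p : 'M[F]_n := f *m b - f *m b *m f.
pose q : 'M[F]_n := b *m f - f *m b *m f.
have Bpq (c : F) : c != 0 -> c != 1 -> B (c *: p - q).
  move=> c0 c1; rewrite -[_ - q]scale1r -(@mulVf _ (c - 1)) ?subr_eq0 //.
  by rewrite -scalerA -conj_pencil //; do 2!apply: BZ; apply: BB => //; apply: B_conj.
have Bp : B p.
  rewrite -[p]scale1r -(@mulVf _ (l - m)) ?subr_eq0 // -scalerA scalerBl.
  rewrite (_ : l *: p - m *: p = (l *: p - q) - (m *: p - q)).
    by apply: BZ; apply: BB; apply: Bpq.
  by clearbody p q; rewrite opprB addrA subrK.
have p0 : p = 0.
  apply: B_reduced => //.
  have pE : p = f *m b *m (1%:M - f) by rewrite mulmxBr mulmx1.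
  rewrite {2}/p pE -!mulmxA -mulmxBr !mulmxA.
  by rewrite -(mulmxA _ _ f) mulmxBl mul1mx ff subrr mulmx0 !mul0mx.
have Bq : B q.
  have := BZ (-1) (Bpq l l0 l1).
  by rewrite p0 scaler0 sub0r scaleN1r opprK.
have q0 : q = 0.
  apply: B_reduced => //.
  have qE : q = (1%:M - f) *m (b *m f) by rewrite mulmxBl mul1mx mulmxA.
  rewrite {1}/q qE -mulmxBl !mulmxA -(mulmxA _ f) mulmxBr mulmx1 ff subrr.
  by rewrite mulmx0 !mul0mx.
by move/eqP: p0; rewrite subr_eq0 => /eqP ->; move/eqP: q0; rewrite subr_eq0 => /eqP ->.
Qed.

End Pencil.

Lemma closed_field_two_values (F : closedFieldType) :
  exists l m : F, [/\ l != 0, l != 1, m != 0, m != 1 & l != m].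
Proof.
have X_neq0 (c : F) : 'X - c%:P != 0 by rewrite polyXsubC_eq0.
have [l] : exists l : F, ~~ root (('X - 0%:P) * ('X - 1%:P)) l.
  by apply/closed_nonrootP; rewrite mulf_neq0.
rewrite rootM !root_XsubC negb_or => /andP[l0 l1].
have [m] : exists m : F, ~~ root (('X - 0%:P) * ('X - 1%:P) * ('X - l%:P)) m.
  by apply/closed_nonrootP; rewrite !mulf_neq0.
rewrite !rootM !root_XsubC !negb_or => /andP[/andP[m0 m1] ml].
by exists l, m; split; rewrite // eq_sym.
Qed.

(** * Polynomial identities on a Zariski dense set *)

Section Density.
Variables (F : fieldType) (n : nat).

Definition generic_mx : 'M[mpoly.mpoly (n * n) F]_n :=
  \matrix_(i, k) mpoly.mpolyX F (mpoly.mnm1 (mxvec_index i k)).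

Lemma meval_generic_mx (M : 'M[F]_n) :
  map_mx (mpoly.meval (mxvec M 0)) generic_mx = M.
Proof. by apply/matrixP => i k; rewrite !mxE mpoly.mevalXU mxvecE. Qed.

Lemma zariski_dense_vanishing (X Y : set 'M[F]_n)
    (Q : 'M[mpoly.mpoly (n * n) F]_n) : zariski_dense X Y ->
  (forall M, X M -> map_mx (mpoly.meval (mxvec M 0)) Q = 0) ->
  forall M, Y M -> map_mx (mpoly.meval (mxvec M 0)) Q = 0.
Proof.
move=> [_ Y_closure] QX M /Y_closure.
pose P := [set p | exists i k, p = Q i k].
move=> /(_ [set N | forall p, P p -> mpoly.meval (mxvec N 0) p = 0]) /= PM.
apply/matrixP => i k; rewrite !mxE; apply: PM; last by exists i, k.
split; first by exists P.
by move=> N /QX/matrixP QN p [i' [k' ->]]; have := QN i' k'; rewrite !mxE.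
Qed.

Lemma map_meval_const (M N : 'M[F]_n) :
  map_mx (mpoly.meval (mxvec M 0)) (map_mx (@mpoly.mpolyC _ _) N) = N.
Proof. by apply/matrixP => i k; rewrite !mxE mpoly.mevalC. Qed.

(** Commuting with [C] is a linear, hence closed, condition. *)
Lemma zariski_dense_commute (X Y : set 'M[F]_n) (C : 'M[F]_n) :
  zariski_dense X Y -> (forall M, X M -> C *m M = M *m C) ->
  forall M, Y M -> C *m M = M *m C.
Proof.
move=> XY XC M YM; apply/eqP; rewrite -subr_eq0; apply/eqP.
pose c := map_mx (@mpoly.mpolyC (n * n) F) C.
have Q_eval N : map_mx (mpoly.meval (mxvec N 0))
    (c *m generic_mx - generic_mx *m c) = C *m N - N *m C.
  by rewrite map_mxB !map_mxM map_meval_const meval_generic_mx.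
rewrite -Q_eval; apply: (zariski_dense_vanishing XY _ YM) => N XN.
by rewrite Q_eval XC // subrr.
Qed.

(** For invertible [M] and [g'] inverse to [g] this is [\det M] times the conjugate
    of [b] by [g *m M *m g']; the adjugate in place of the inverse makes it
    polynomial in [M]. *)
Definition conj_adj (g g' b M : 'M[F]_n) : 'M[F]_n :=
  g *m M *m g' *m b *m (g *m \adj M *m g').

Lemma conj_adjE (g g' b M : 'M[F]_n) : M \in unitmx ->
  conj_adj g g' b M =
  \det M *: (g *m M *m g' *m b *m (g *m invmx M *m g')).
Proof.
move=> M_unit; rewrite /conj_adj.
have -> : \adj M = \det M *: invmx M.
  by rewrite -[LHS](mulKmx M_unit) mul_mx_adj mul_mx_scalar.
by rewrite -scalemxAr -scalemxAl -scalemxAr.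
Qed.

Lemma zariski_dense_conj_commute (X Y : set 'M[F]_n) (g g' b C : 'M[F]_n) :
    zariski_dense X Y ->
    (forall M, X M -> conj_adj g g' b M *m C = C *m conj_adj g g' b M) ->
  forall M, Y M -> conj_adj g g' b M *m C = C *m conj_adj g g' b M.
Proof.
move=> XY XC M YM; apply/eqP; rewrite -subr_eq0; apply/eqP.
pose c (N : 'M[F]_n) := map_mx (@mpoly.mpolyC (n * n) F) N.
pose h := c g *m generic_mx *m c g' *m c b *m (c g *m \adj generic_mx *m c g').
have Q_eval N : map_mx (mpoly.meval (mxvec N 0)) (h *m c C - c C *m h) =
    conj_adj g g' b N *m C - C *m conj_adj g g' b N.
  by rewrite map_mxB !map_mxM map_mx_adj !map_meval_const !meval_generic_mx.
rewrite -Q_eval; apply: (zariski_dense_vanishing XY _ YM) => N XN.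
by rewrite Q_eval XC // subrr.
Qed.

End Density.

(** * The torus and its conjugates *)

Lemma invmx_unique (R : comUnitRingType) (n : nat) (M N : 'M[R]_n) :
  M *m N = 1%:M -> M \in unitmx /\ invmx M = N.
Proof.
move=> MN; have [M_unit _] := mulmx1_unit MN; split=> //.
by rewrite -[LHS]mulmx1 -MN mulKmx.
Qed.

Section Torus.
Variables (R : comUnitRingType) (S : comUnitAlgType R) (n : nat) (w : 'I_n -> S).
Hypothesis w_basis : is_basis w.

Lemma mult_mxV (a : S) : a \is a GRing.unit ->
  mult_mx w a \in unitmx /\ invmx (mult_mx w a) = mult_mx w a^-1.
Proof.
by move=> a_unit; apply: invmx_unique; rewrite -mult_mxM // mulrV // mult_mx1.
Qed.

Lemma torus_subgroup : subgroup_GL (torus w).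
Proof.
split=> [_ [a a_unit <-]||_ _ [a a_unit <-] [b b_unit <-]|_ [a a_unit <-]].
- by have [] := mult_mxV a_unit.
- by exists 1; [exact: unitr1 | exact: mult_mx1].
- by exists (a * b); [rewrite /= unitrM a_unit | exact: mult_mxM].
- by exists a^-1; [rewrite /= unitrV | have [_ ->] := mult_mxV a_unit].
Qed.

Lemma torus_comm x y : torus w x -> torus w y -> x *m y = y *m x.
Proof. by move=> [a _ <-] [b _ <-]; exact: mult_mxC. Qed.

Lemma commutant_torus (M : 'M[R]_n) : M \in unitmx ->
  (forall a, M *m mult_mx w a = mult_mx w a *m M) -> torus w M.
Proof.
move=> M_unit Mcomm.
have [a aE] := commutant_mult_mx w_basis Mcomm.
have [c|b bE] := @commutant_mult_mx _ _ _ _ w_basis (invmx M).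
  by rewrite -[LHS](mulmxK M_unit) -(mulmxA _ _ M) -Mcomm mulKmx.
exists a => //=; apply/unitrPr; exists b.
apply: (mult_mx_inj w_basis).
by rewrite mult_mxM // -aE -bE mulmxV // mult_mx1.
Qed.

End Torus.

(** The units span the algebra, because each idempotent [e i] is a combination of
    1 and of the unit [1 + (l - 1) e i]. *)
Lemma torus_commute_mult_mx (F : fieldType) (A : comUnitAlgType F) (n : nat)
    (w : 'I_n -> A) (m : nat) (e : 'I_m -> A) (l : F) (C : 'M[F]_n) :
    is_basis w -> (forall i, e i * e i = e i) ->
    (forall a, exists c : 'I_m -> F, a = \sum_i c i *: e i) ->
    l != 0 -> l != 1 ->
    (forall M, torus w M -> C *m M = M *m C) ->
  forall a, C *m mult_mx w a = mult_mx w a *m C.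
Proof.
move=> w_basis e_idem e_span l0 l1 TC a.
suff eC i : C *m mult_mx w (e i) = mult_mx w (e i) *m C.
  have [c ->] := e_span a; rewrite mult_mx_sum // mulmx_sumr mulmx_suml.
  by apply: eq_bigr => i _; rewrite mult_mxZ // -scalemxAr -scalemxAl eC.
pose u := 1 + (l - 1) *: e i.
have u_unit : u \is a GRing.unit.
  by apply/unitrPr; exists (1 + (l^-1 - 1) *: e i); apply: unit_idempotent.
(* Cancel the contribution of 1 in the commutation of C with u. *)
have := TC _ (ex_intro2 _ _ u u_unit erefl).
rewrite mult_mxD // mult_mxZ // mult_mx1 // mulmxDr mulmxDl mulmx1 mul1mx.
move/addrI; rewrite -scalemxAr -scalemxAl; apply: scalerI.
by rewrite subr_eq0.
Qed.

(** Let [B] be the image of [A]. Conjugating [b] by [g x g'] with [x] in [X] stays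
    in [B], which is its own commutant; by density the same holds for all [x] in
    the torus, in particular for the units [1 + (c - 1) f] attached to an
    idempotent [f]. As [B] is reduced, [g f g'] commutes with [b]. *)
Lemma conj_commute_of_normalizing (F : closedFieldType) (A : comUnitAlgType F)
    (n : nat) (w : 'I_n -> A) (X : set 'M[F]_n) (g g' b : 'M[F]_n) :
    is_basis w -> semisimple A -> zariski_dense X (torus w) ->
    g' *m g = 1%:M -> range (mult_mx w) b ->
    (forall M, X M ->
       range (mult_mx w) (g *m M *m g' *m b *m (g *m invmx M *m g'))) ->
  forall a, g *m mult_mx w a *m g' *m b = b *m (g *m mult_mx w a *m g').
Proof.
move=> w_basis A_ss X_dense g'g Bb X_norm a.
have torus_unitmx M : torus w M -> M \in unitmx.
  by have [TU _ _ _] := torus_subgroup w_basis; move/TU.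
have gg' : g *m g' = 1%:M by apply: mulmx1C.
have torus_norm M : torus w M ->
    range (mult_mx w) (g *m M *m g' *m b *m (g *m invmx M *m g')).
  move=> TM; have M_unit : M \in unitmx := torus_unitmx _ TM.
  suff [c cE] : exists c,
      g *m M *m g' *m b *m (g *m invmx M *m g') = mult_mx w c by exists c.
  apply: commutant_mult_mx => // c.
  have : conj_adj g g' b M *m mult_mx w c = mult_mx w c *m conj_adj g g' b M.
    apply: (zariski_dense_conj_commute X_dense _ TM) => N XN.
    rewrite conj_adjE; last exact/torus_unitmx/(proj1 X_dense).
    have [d _ <-] := X_norm _ XN.
    by rewrite -scalemxAl -scalemxAr mult_mxC.
  rewrite conj_adjE // -scalemxAl -scalemxAr; apply: scalerI.
  by rewrite -unitfE -unitmxE.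
have [m [e [e_idem e_span]]] := semisimple_split w_basis A_ss.
suff eb i : g *m mult_mx w (e i) *m g' *m b = b *m (g *m mult_mx w (e i) *m g').
  have [c ->] := e_span a; rewrite mult_mx_sum // mulmx_sumr !mulmx_suml mulmx_sumr.
  apply: eq_bigr => i _; rewrite mult_mxZ // -scalemxAr -!scalemxAl eb.
  by rewrite -scalemxAr.
set f := g *m mult_mx w (e i) *m g'.
have unitE c : 1%:M + (c - 1) *: f = g *m mult_mx w (1 + (c - 1) *: e i) *m g'.
  rewrite mult_mxD // mult_mxZ // mult_mx1 // mulmxDr mulmxDl mulmx1 gg'.
  by rewrite -scalemxAr -scalemxAl.
have [l [l' [l0 l1 l'0 l'1 ll']]] := closed_field_two_values F.
apply: (@idempotent_commutes _ _ (range (mult_mx w)) _ _ _ f b l l') => //.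
- by move=> _ _ [c _ <-] [d _ <-]; exists (c - d); rewrite ?mult_mxB.
- by move=> c _ [d _ <-]; exists (c *: d); rewrite ?mult_mxZ.
- move=> _ [c _ <-]; rewrite -(mult_mxM w_basis) -(mult_mx0 w_basis).
  by move/(mult_mx_inj w_basis)/(semisimple_reduced A_ss) => ->.
- rewrite /f !mulmxA -(mulmxA _ g') g'g mulmx1.
  rewrite -[g *m _ *m mult_mx w _]mulmxA -mult_mxM //.
  by rewrite e_idem.
move=> c c_neq0; rewrite !unitE.
have u_inv := unit_idempotent (e_idem i) c_neq0.
set u := 1 + (c - 1) *: e i in u_inv *.
have u_unit : u \is a GRing.unit by apply/unitrPr; eexists; exact: u_inv.
have -> : 1 + (c^-1 - 1) *: e i = u^-1 by rewrite -[LHS](mulKr u_unit) u_inv mulr1.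
have [_ <-] := mult_mxV w_basis u_unit.
by apply: torus_norm; exists u.
Qed.

(** * Garlands of a subgroup *)

Section Garland.
Variables (R : comUnitRingType) (n : nat) (T : set 'M[R]_n).

(** Only an edge going up, from [H] to a [K] in which [H] is normal, could leave
    the normalizer of [T]. But if [H] normalizes [T], then so do the [K]-conjugates
    of [T], which lie in [H]; hence they are contained in [T], and conjugation by
    [g] and by [g^-1] gives equality. *)
Lemma lower_garland_normalizer :
    subgroup_GL T -> (forall x y, T x -> T y -> x *m y = y *m x) ->
    (forall g, GL n R g ->
       conjugate g T `<=` normalizer (GL n R) T -> conjugate g T `<=` T) ->
  lower_garland T (GL n R) = Lat T (normalizer (GL n R) T).
Proof.
move=> T_group T_comm T_conj.
have [TG T1 TM TV] := T_group.
have TN : T `<=` normalizer (GL n R) T.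
  move=> g Tg; split; first exact: TG.
  apply/seteqP; split=> [_ [x Tx <-]|x Tx].
    by rewrite (T_comm g x) // mulmxK //; apply: TG.
  by exists x => //; rewrite (T_comm g x) // mulmxK //; apply: TG.
have Lat_T : Lat T (GL n R) T by split; first exact: T_group.
apply/seteqP; split=> [H [_ TH]|H [H_group TH HN]]; last first.
  (* A subgroup normalizing T is joined to T by a single edge. *)
  have Lat_H : Lat T (GL n R) H by split=> // x /HN[].
  split=> //; apply: Relation_Operators.rt_step; split=> //; left.
  by split=> // g /HN[].
suff step K L : normality_edge T (GL n R) K L ->
    Lat T (normalizer (GL n R) T) K -> Lat T (normalizer (GL n R) T) L.
  have Lat_TN : Lat T (normalizer (GL n R) T) T by split; first exact: T_group.
  suff closed K L :
      Relation_Operators.clos_refl_trans _ (normality_edge T (GL n R)) K L ->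
      Lat T (normalizer (GL n R) T) K -> Lat T (normalizer (GL n R) T) L.
    exact: closed TH Lat_TN.
  by elim=> [K' L' /step//|//|K' L' M _ IHK _ IHL /IHK/IHL].
case=> [_ [L_group TL LG] KL] [K_group TK KN]; split=> // g Lg.
case: KL => [[KL K_norm]|[LK _]]; last exact/KN/LK.
have conj_sub h : L h -> conjugate h T `<=` T.
  move=> Lh; apply: T_conj; first exact: LG.
  apply: (subset_trans _ KN); rewrite -(K_norm h Lh).
  by move=> _ [x Tx <-]; exists x => //; apply: TK.
have g_unit := LG _ Lg; split=> //.
apply/seteqP; split; first exact: conj_sub.
move=> x Tx; exists (invmx g *m x *m g); last first.
  by rewrite !mulmxA mulmxV // mul1mx mulmxK.
have [_ _ _ LV] := L_group.
by apply: (conj_sub _ (LV _ Lg)); exists x; rewrite ?invmxK.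
Qed.

End Garland.

Theorem theorem6p2 (R : idomainType) (S : comUnitAlgType R)
    (R_subring : injective (fun r : R => r%:A : S))
    (n : nat) (omega : 'I_n -> S) (omega_basis : is_basis omega)
    (kbar : closedFieldType) (j : {rmorphism {fraction R} -> kbar})
    (kbar_algebraic : forall x : kbar, algebraicOver j x)
    (A : comUnitAlgType kbar) (iota : {rmorphism S -> A})
    (A_tensor : is_tensor_algebra (fun r : R => j (tofrac r)) iota)
    (A_semisimple : semisimple A)
    (T_dense : zariski_dense
       (map_mx (fun r : R => j (tofrac r)) @` torus omega)
       (torus (fun i => iota (omega i)))) :
  lower_garland (torus omega) (GL n R) =
  Lat (torus omega) (normalizer (GL n R) (torus omega)).
Proof.
have T_group := torus_subgroup omega_basis.
have [TG _ _ _] := T_group.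
apply: lower_garland_normalizer => //; first exact: torus_comm.
move=> g g_unit gT_norm _ [x Tx <-].
pose phi : {rmorphism R -> kbar} := j \o @tofrac R.
have phi_inj m p : injective (map_mx phi : 'M_(m, p) -> 'M_(m, p)).
  move=> M N /matrixP MN; apply/matrixP => i k; have := MN i k.
  by rewrite !mxE /= => /fmorph_inj/eqP; rewrite tofrac_eq => /eqP.
pose w i := iota (omega i).
have w_basis : is_basis w := tensor_basis omega_basis (phi := phi) A_tensor.
have iotaE s : mult_mx w (iota s) = map_mx phi (mult_mx omega s).
  exact: (mult_mx_tensor omega_basis (phi := phi) A_tensor).
have gV : invmx g *m g = 1%:M by rewrite mulVmx.
have phi_gV : map_mx phi (invmx g) *m map_mx phi g = 1%:M.
  by rewrite -map_mxM gV map_mx1.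
have conj_comm y : torus omega y ->
    g *m x *m invmx g *m y = y *m (g *m x *m invmx g).
  move=> Ty; apply: phi_inj; rewrite !map_mxM.
  have [a _ aE] := Tx; rewrite -aE -iotaE.
  apply: (conj_commute_of_normalizing w_basis A_semisimple T_dense phi_gV).
    by have [c _ <-] := Ty; exists (iota c).
  move=> _ [M TM <-].
  have M_unit := TG _ TM.
  have gMT : normalizer (GL n R) (torus omega) (g *m M *m invmx g).
    by apply: gT_norm; exists M.
  have [_ gM_norm] := gMT.
  (* g M g^-1 normalizes T, so it conjugates y into T. *)
  have [c _ cE] : torus omega
      (g *m M *m invmx g *m y *m (g *m invmx M *m invmx g)).
    rewrite -gM_norm; exists y => //; congr (_ *m _).
    have [] // := @invmx_unique _ _ (g *m M *m invmx g) (g *m invmx M *m invmx g).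
    by rewrite !mulmxA mulmxKV // mulmxK // mulmxV.
  have [_ phiMV] : map_mx phi M \in unitmx /\
      invmx (map_mx phi M) = map_mx phi (invmx M).
    by apply: invmx_unique; rewrite -map_mxM mulmxV // map_mx1.
  by exists (iota c) => //; rewrite iotaE cE phiMV !map_mxM.
have gxg_unit : g *m x *m invmx g \in unitmx.
  by rewrite !unitmx_mul unitmx_inv (TG _ Tx) !andbT /=; apply/andP.
apply: commutant_torus => // s; apply: phi_inj; rewrite !map_mxM -iotaE.
have [m [e [e_idem e_span]]] := semisimple_split w_basis A_semisimple.
have [l [_ [l0 l1 _ _ _]]] := closed_field_two_values kbar.
apply: (torus_commute_mult_mx w_basis e_idem e_span l0 l1) => M TM.
apply: (zariski_dense_commute T_dense _ TM) => _ [y Ty <-].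
have := congr1 (map_mx phi) (conj_comm y Ty); rewrite !map_mxM; exact.
Qed.
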